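(* Let $g_1,\dots,g_t\in\mathbb{C}[x,y]$, and assume that the subscheme of $\mathbb{A}^2$ associated to the ideal $\mathfrak{b}:=(g_1,\dots,g_t)$ is $0$-dimensional with the origin $O$ contained in its support; let $\mathfrak{m}:=(x,y)$. Then there is an isomorphism of $\mathbb{C}$-algebras $$\mathbb{C}[x,y]_{\mathfrak{m}}/\mathfrak{b}\,\mathbb{C}[x,y]_{\mathfrak{m}}\;\cong\;\mathbb{C}\{x,y\}/\mathfrak{b}\,\mathbb{C}\{x,y\}.$$
   Context: $\mathbb{C}\{x,y\}$ is the ring of convergent power series in $x,y$ over $\mathbb{C}$; $\mathbb{C}[x,y]_{\mathfrak{m}}$ is the localization of the polynomial ring at $\mathfrak{m}=(x,y)$, which embeds naturally in $\mathbb{C}\{x,y\}$. $\mathfrak{b}\,\mathbb{C}\{x,y\}$ denotes the ideal generated by $\mathfrak{b}$ in $\mathbb{C}\{x,y\}$. *)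

(* Defs.v *)
From HB Require Import structures.
From mathcomp Require Import all_boot all_order all_algebra.
From mathcomp Require Import complex mpoly.
From mathcomp Require Import boolp classical_sets reals esum.
From mathcomp Require Import ereal cardinality fsbigop finmap.

Set Implicit Arguments.
Unset Strict Implicit.
Unset Printing Implicit Defensive.

Import Order.TTheory GRing.Theory Num.Theory.

Local Open Scope classical_set_scope.
Local Open Scope ring_scope.

(* Ideals of a commutative ring; the unit ideal is allowed, unlike in the
   library structure [idealr]. *)
Record ideal (A : comPzRingType) := Ideal {
  ideal_pred :> {pred A};
  ideal_zmod_closed : zmod_closed ideal_pred;
  ideal_mulP : forall a x, x \in ideal_pred -> a * x \in ideal_pred }.

HB.instance Definition _ (A : comPzRingType) (I : ideal A) :=
  GRing.isZmodClosed.Build A (ideal_pred I) (ideal_zmod_closed I).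

Lemma idealM (A : comPzRingType) (I : ideal A) (a x : A) : x \in I -> a * x \in I.
Proof. exact: ideal_mulP. Qed.

Section GeneratedIdeal.
Variables (A : comPzRingType) (S : set A).

Definition gen_pred (x : A) : bool :=
  `[< exists (n : nat) (a s : 'I_n -> A),
        (forall i, S (s i)) /\ x = \sum_(i < n) a i * s i >].

Lemma gen_predM a x : x \in gen_pred -> a * x \in gen_pred.
Proof.
move=> /asboolP[n [c [s [Ss ->]]]]; apply/asboolP.
exists n, (fun i => a * c i), s; split=> //.
by rewrite mulr_sumr; apply: eq_bigr => i _; rewrite mulrA.
Qed.

Lemma gen_zmod_closed : zmod_closed gen_pred.
Proof.
split=> [|x y].
  apply/asboolP; exists 0%N, (fun=> 0), (fun=> 0).
  by split=> [[]//|]; rewrite big_ord0.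
move=> /asboolP[n [c [s [Ss ->]]]] /(gen_predM (-1)).
rewrite mulN1r => /asboolP[p [d [u [Su ->]]]]; apply/asboolP.
exists (n + p)%N, (fun i => match fintype.split i with inl j => c j | inr j => d j end),
  (fun i => match fintype.split i with inl j => s j | inr j => u j end).
split=> [i|]; first by case: (fintype.split i).
by rewrite big_split_ord; congr (_ + _); apply: eq_bigr => i _;
  [rewrite (unsplitK (inl i))|rewrite (unsplitK (inr i))].
Qed.

Definition ideal_gen : ideal A := Ideal gen_zmod_closed gen_predM.

End GeneratedIdeal.

Definition ideal_ext (A B : comPzRingType) (f : {rmorphism A -> B}) (I : ideal A) : ideal B :=
  ideal_gen (f @` [set x | x \in I]).

Definition prime_ideal (A : comPzRingType) (P : ideal A) : Prop :=
  1 \notin P /\ forall x y, x * y \in P -> x \in P \/ y \in P.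

Record spec (A : comPzRingType) := Spec {
  spec_ideal :> ideal A;
  specP : prime_ideal spec_ideal }.

Definition zero_locus (A : comPzRingType) (I : ideal A) (P : spec A) : Prop :=
  {subset I <= P}.

Definition prime_chain (A : comPzRingType) (n : nat) (p : 'I_n.+1 -> spec A) : Prop :=
  forall i j : 'I_n.+1, (i < j)%N ->
    {subset p i <= p j} /\ ~ {subset p j <= p i}.

Definition krull_dim_is (A : comPzRingType) (d : nat) : Prop :=
  (exists p : 'I_d.+1 -> spec A, prime_chain p) /\
  (forall n (p : 'I_n.+1 -> spec A), prime_chain p -> (n <= d)%N).

(* The quotient by an arbitrary ideal is possibly the zero ring, hence only a
   [comPzRingType]; the library ring [{ideal_quot _}] and the structure [algType]
   both require 1 != 0.  A K-algebra structure on the quotient is thus its ring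
   structure together with its [lmodType K] structure; see [quot_scaleAl]. *)
Definition quot (A : comPzRingType) (I : ideal A) : Type := Quotient.quot I.

Section Quotient.
Variables (A : comPzRingType) (I : ideal A).
Local Open Scope quotient_scope.

HB.instance Definition _ := GRing.Zmodule.on (quot I).
HB.instance Definition _ : EqQuotient A (Quotient.equiv I) (quot I) :=
  EqQuotient.on (quot I).
HB.instance Definition _ :=
  @isZmodQuotient.Build A (Quotient.equiv I) 0 -%R +%R (quot I)
    (lock _) (@Quotient.pi_opp A I) (@Quotient.pi_add A I).

Lemma quot_eqP x y : reflect (\pi_(quot I) x = \pi_(quot I) y) (x - y \in I).
Proof. by rewrite (Quotient.idealrBE I); exact: eqP. Qed.

Lemma pi_quot_add : {morph \pi_(quot I) : x y / x + y}.
Proof. exact: (@Quotient.pi_add A I). Qed.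

Definition quot_one : quot I := lift_cst (quot I) 1.
Definition quot_mul := lift_op2 (quot I) *%R.

Canonical pi_quot_one := PiConst quot_one.

Lemma pi_quot_mul : {morph \pi_(quot I) : x y / x * y >-> quot_mul x y}.
Proof.
move=> x y; unlock quot_mul; apply/eqP; rewrite piE Quotient.equivE.
rewrite -[_ * _](addrNK (x * repr (\pi_(quot I) y))) -mulrBr.
rewrite -addrA -mulrBl rpredD //.
  by rewrite idealM // Quotient.idealrDE opprK reprK.
by rewrite mulrC idealM // Quotient.idealrDE opprK reprK.
Qed.
Canonical pi_quot_mul_morph := PiMorph2 pi_quot_mul.

Lemma quot_mulA : associative quot_mul.
Proof. by move=> x y z; rewrite -[x]reprK -[y]reprK -[z]reprK !piE mulrA. Qed.

Lemma quot_mulC : commutative quot_mul.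
Proof. by move=> x y; rewrite -[x]reprK -[y]reprK !piE mulrC. Qed.

Lemma quot_mul1 : left_id quot_one quot_mul.
Proof. by move=> x; rewrite -[x]reprK !piE mul1r. Qed.

Lemma quot_mulDl : left_distributive quot_mul +%R.
Proof.
move=> x y z; rewrite -[x]reprK -[y]reprK -[z]reprK.
by rewrite !piE mulrDl.
Qed.

HB.instance Definition _ :=
  GRing.Zmodule_isComPzRing.Build (quot I) quot_mulA quot_mulC quot_mul1 quot_mulDl.

End Quotient.

Section QuotientModule.
Variables (K : comNzRingType) (A : comAlgType K) (I : ideal A).
Local Open Scope quotient_scope.
Local Notation pi := (\pi_(quot I)).

Definition quot_scale (c : K) := lift_op1 (quot I) (fun x : A => c *: x).

Lemma pi_quot_scale c (x : A) : pi (c *: x) = quot_scale c (pi x).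
Proof.
unlock quot_scale; apply/quot_eqP; rewrite -scalerBr -mulr_algl idealM //.
by apply/quot_eqP; rewrite reprK.
Qed.

Lemma quot_scaleA a b x : quot_scale a (quot_scale b x) = quot_scale (a * b) x.
Proof. by rewrite -[x]reprK -!pi_quot_scale scalerA. Qed.

Lemma quot_scale1 : left_id 1 quot_scale.
Proof. by move=> x; rewrite -[x]reprK -pi_quot_scale scale1r. Qed.

Lemma quot_scaleDr : right_distributive quot_scale +%R.
Proof.
move=> a x y; rewrite -[x]reprK -[y]reprK -!pi_quot_scale.
by rewrite -!pi_quot_add -pi_quot_scale scalerDr.
Qed.

Lemma quot_scaleDl x : {morph quot_scale^~ x : a b / a + b}.
Proof. by move=> a b; rewrite -[x]reprK -!pi_quot_scale scalerDl pi_quot_add. Qed.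

HB.instance Definition _ :=
  GRing.Zmodule_isLmodule.Build K (quot I)
    quot_scaleA quot_scale1 quot_scaleDr quot_scaleDl.

Lemma quot_scaleAl (c : K) (x y : quot I) : c *: (x * y) = (c *: x) * y.
Proof.
have piM u v : pi u * pi v = pi (u * v) by rewrite pi_quot_mul.
have piZ u : c *: pi u = pi (c *: u) by rewrite pi_quot_scale.
by rewrite -[x]reprK -[y]reprK !(piM, piZ) scalerAl.
Qed.

End QuotientModule.

Section Localization.
Variables (A : idomainType) (P : spec A).

(* As A is a domain, its localization at P is the subring of the fractions f / s
   with s outside P in the fraction field. *)
Definition loc_pred : pred {fraction A} := fun x =>
  `[< exists f s : A, s \notin P /\ x = tofrac f / tofrac s >].

Lemma spec_neq0 (s : A) : s \notin P -> tofrac s != 0.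
Proof. by move=> Ps; rewrite tofrac_eq0; apply: contraNneq Ps => ->; exact: rpred0. Qed.

Lemma spec_mulN (s t : A) : s \notin P -> t \notin P -> s * t \notin P.
Proof.
by move=> Ps Pt; apply/negP => /(specP P).2[] h; [rewrite h in Ps|rewrite h in Pt].
Qed.

Lemma loc_subring_closed : subring_closed loc_pred.
Proof.
split.
- by apply/asboolP; exists 1, 1; rewrite tofrac1 divr1; split=> //; exact: (specP P).1.
- move=> _ _ /asboolP[f [s [Ps ->]]] /asboolP[g [t [Pt ->]]]; apply/asboolP.
  exists (f * t - g * s), (s * t); split; first exact: spec_mulN.
  by rewrite tofracB !tofracM -mulNr addf_div ?spec_neq0// mulNr.
- move=> _ _ /asboolP[f [s [Ps ->]]] /asboolP[g [t [Pt ->]]]; apply/asboolP.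
  exists (f * g), (s * t); split; first exact: spec_mulN.
  by rewrite !tofracM mulf_div.
Qed.

HB.instance Definition _ := GRing.isSubringClosed.Build {fraction A} loc_pred
  loc_subring_closed.

Record localization := Localization {
  loc_val :> {fraction A};
  _ : loc_val \in loc_pred }.

HB.instance Definition _ := [isSub for loc_val].
HB.instance Definition _ := [Choice of localization by <:].
HB.instance Definition _ := [SubChoice_isSubComNzRing of localization by <:].

Lemma to_loc_subproof (f : A) : tofrac f \in loc_pred.
Proof. by apply/asboolP; exists f, 1; rewrite tofrac1 divr1; split=> //; exact: (specP P).1. Qed.

Definition to_loc (f : A) : localization := Localization (to_loc_subproof f).

End Localization.

Section OriginIdeal.
Variables (n : nat) (K : fieldType).

Definition origin_ideal : ideal {mpoly K[n]} := ideal_gen (range (fun i : 'I_n => 'X_i)).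

Lemma mcoeff0M (f g : {mpoly K[n]}) : (f * g)@_0%MM = f@_0%MM * g@_0%MM.
Proof. exact: rmorphM. Qed.

Lemma origin_idealP (f : {mpoly K[n]}) : (f \in origin_ideal) = (f@_0%MM == 0).
Proof.
apply/asboolP/eqP => [[k [a [s [Ss ->]]]]|f0].
  rewrite raddf_sum big1//= => i _; rewrite mcoeff0M.
  by have [j _ <-] := Ss i; rewrite mcoeffX mnm1_eq0 mulr0.
have mP (m : 'X_{1..n}) : m != 0%MM -> 'X_[m] \in origin_ideal.
  move=> m0; have [i mi] : exists i, m i != 0%N.
    by apply/existsP; apply: contraNT m0 => /existsPn h; apply/eqP/mnmP => i;
      rewrite mnm0E; apply/eqP; move: (h i); rewrite negbK.
  rewrite -(submK (m := U_(i)%MM) (m' := m)) ?lep1mP// mpolyXD.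
  apply: idealM; apply/asboolP; exists 1%N, (fun=> 1), (fun=> 'X_i).
  by split=> [_|]; [exists i|rewrite big_ord1 mul1r].
suff : f \in origin_ideal by move/asboolP.
rewrite [f]mpolyE; apply: rpred_sum => m _.
have [->|m0] := eqVneq m 0%MM; first by rewrite f0 scale0r rpred0.
by rewrite -mul_mpolyC; apply/idealM/mP.
Qed.

Lemma origin_ideal_prime : prime_ideal origin_ideal.
Proof.
split=> [|x y]; first by rewrite origin_idealP mcoeff1 eqxx oner_eq0.
by rewrite !origin_idealP mcoeff0M mulf_eq0 => /orP.
Qed.

Definition origin : spec {mpoly K[n]} := Spec origin_ideal_prime.

Definition loc_mpoly : Type := localization origin.
HB.instance Definition _ := GRing.ComNzRing.on loc_mpoly.

Definition to_loc_mpoly (f : {mpoly K[n]}) : loc_mpoly := to_loc origin f.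

Lemma to_loc_mpoly_zmod : zmod_morphism to_loc_mpoly.
Proof. by move=> f g; apply: val_inj; rewrite /= tofracB. Qed.
Lemma to_loc_mpoly_monoid : monoid_morphism to_loc_mpoly.
Proof. by split=> [|f g]; apply: val_inj; rewrite /= ?tofrac1 ?tofracM. Qed.
HB.instance Definition _ :=
  GRing.isZmodMorphism.Build {mpoly K[n]} loc_mpoly to_loc_mpoly to_loc_mpoly_zmod.
HB.instance Definition _ :=
  GRing.isMonoidMorphism.Build {mpoly K[n]} loc_mpoly to_loc_mpoly to_loc_mpoly_monoid.

Definition loc_scale (c : K) (x : loc_mpoly) : loc_mpoly := to_loc_mpoly c%:MP * x.

Lemma loc_scaleA a b x : loc_scale a (loc_scale b x) = loc_scale (a * b) x.
Proof. by rewrite /loc_scale mulrA -rmorphM -mpolyCM. Qed.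
Lemma loc_scale1 : left_id 1 loc_scale.
Proof. by move=> x; rewrite /loc_scale mpolyC1 rmorph1 mul1r. Qed.
Lemma loc_scaleDr : right_distributive loc_scale +%R.
Proof. by move=> a x y; rewrite /loc_scale mulrDr. Qed.
Lemma loc_scaleDl x : {morph loc_scale^~ x : a b / a + b}.
Proof. by move=> a b; rewrite /loc_scale mpolyCD rmorphD mulrDl. Qed.
HB.instance Definition _ := GRing.Zmodule_isLmodule.Build K loc_mpoly
  loc_scaleA loc_scale1 loc_scaleDr loc_scaleDl.

Lemma loc_scaleAl (c : K) (x y : loc_mpoly) : c *: (x * y) = (c *: x) * y.
Proof. exact: mulrA. Qed.
HB.instance Definition _ := GRing.Lmodule_isLalgebra.Build K loc_mpoly loc_scaleAl.
HB.instance Definition _ := GRing.Lalgebra_isComAlgebra.Build K loc_mpoly.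

End OriginIdeal.


Section FormalPowerSeries.
Variables (n : nat) (K : comNzRingType).

Record fps := Fps { fps_coef : 'X_{1..n} -> K }.

HB.instance Definition _ := gen_eqMixin fps.
HB.instance Definition _ := gen_choiceMixin fps.

Lemma fpsP (a b : fps) : (forall m, fps_coef a m = fps_coef b m) -> a = b.
Proof. by case: a b => [a] [b] /= h; congr Fps; apply/funext. Qed.

Definition fps_zero := Fps (fun=> 0).
Definition fps_opp (a : fps) := Fps (fun m => - fps_coef a m).
Definition fps_add (a b : fps) := Fps (fun m => fps_coef a m + fps_coef b m).
Definition fps_one := Fps (fun m => (m == 0%MM)%:R).
Definition fps_mul (a b : fps) := Fps (fun m =>
  \sum_(k : 'X_{1..n < (mdeg m).+1, (mdeg m).+1} | m == (k.1 + k.2)%MM)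
    fps_coef a k.1 * fps_coef b k.2).
Definition fps_scale (c : K) (a : fps) := Fps (fun m => c * fps_coef a m).

Lemma fps_addA : associative fps_add.
Proof. by move=> a b c; apply/fpsP => m /=; rewrite addrA. Qed.
Lemma fps_addC : commutative fps_add.
Proof. by move=> a b; apply/fpsP => m /=; rewrite addrC. Qed.
Lemma fps_add0 : left_id fps_zero fps_add.
Proof. by move=> a; apply/fpsP => m /=; rewrite add0r. Qed.
Lemma fps_addN : left_inverse fps_zero fps_opp fps_add.
Proof. by move=> a; apply/fpsP => m /=; rewrite addNr. Qed.

HB.instance Definition _ :=
  GRing.isZmodule.Build fps fps_addA fps_addC fps_add0 fps_addN.

(* Truncation to total degree < d reduces the ring axioms to those of
   polynomials. *)
Definition fps_trunc (d : nat) (a : fps) : {mpoly K[n]} :=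
  \sum_(m : 'X_{1..n < d}) fps_coef a m *: 'X_[m].

Lemma fps_truncE d a m : (mdeg m < d)%N -> (fps_trunc d a)@_m = fps_coef a m.
Proof. exact: mcoeff_mpoly. Qed.

Lemma eq_mcoeffM d (p q p' q' : {mpoly K[n]}) (m : 'X_{1..n}) : (mdeg m < d)%N ->
  (forall k, (mdeg k < d)%N -> p@_k = p'@_k) ->
  (forall k, (mdeg k < d)%N -> q@_k = q'@_k) -> (p * q)@_m = (p' * q')@_m.
Proof.
move=> md pp qq; rewrite !mcoeffM; apply: eq_bigr => -[k l] _ /=.
by rewrite pp ?qq//; apply: leq_trans md; exact: bmdeg.
Qed.

Lemma fps_mulE d a b m : (mdeg m < d)%N ->
  fps_coef (fps_mul a b) m = (fps_trunc d a * fps_trunc d b)@_m.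
Proof.
move=> md; rewrite mcoeffM; apply: eq_bigr => -[k l] _ /=.
by rewrite !fps_truncE//; apply: leq_trans md; exact: bmdeg.
Qed.

Lemma fps_mulA : associative fps_mul.
Proof.
move=> a b c; apply/fpsP => m; have md := ltnSn (mdeg m).
rewrite !(fps_mulE _ _ md); set d := (mdeg m).+1.
transitivity (fps_trunc d a * (fps_trunc d b * fps_trunc d c))@_m.
  by apply: (eq_mcoeffM md) => // k kd; rewrite fps_truncE// (fps_mulE _ _ kd).
rewrite mulrA; apply: (eq_mcoeffM md) => // k kd.
by rewrite fps_truncE// (fps_mulE _ _ kd).
Qed.

Lemma fps_mulC : commutative fps_mul.
Proof. by move=> a b; apply/fpsP => m; rewrite !(fps_mulE _ _ (ltnSn _)) mulrC. Qed.

Lemma fps_mul1 : left_id fps_one fps_mul.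
Proof.
move=> a; apply/fpsP => m; have md := ltnSn (mdeg m).
rewrite (fps_mulE _ _ md) -(fps_truncE a md) -[in RHS](mul1r (fps_trunc _ a)).
by apply: (eq_mcoeffM md) => // k kd; rewrite fps_truncE// mcoeff1.
Qed.

Lemma fps_mulDl : left_distributive fps_mul fps_add.
Proof.
move=> a b c; apply/fpsP => m; have md := ltnSn (mdeg m).
rewrite (fps_mulE _ _ md) /= -[X in _ = X + _]/(fps_coef (fps_mul a c) m).
rewrite -[X in _ = _ + X]/(fps_coef (fps_mul b c) m) !(fps_mulE _ _ md).
rewrite -mcoeffD -mulrDl; apply: (eq_mcoeffM md) => // k kd.
by rewrite mcoeffD !fps_truncE.
Qed.

Lemma fps_one_neq0 : fps_one != 0.
Proof.
by apply/eqP => /(congr1 (fun a => fps_coef a 0%MM))/=/eqP; rewrite eqxx oner_eq0.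
Qed.

HB.instance Definition _ := GRing.Zmodule_isComNzRing.Build fps
  fps_mulA fps_mulC fps_mul1 fps_mulDl fps_one_neq0.

Lemma fps_scaleA a b x : fps_scale a (fps_scale b x) = fps_scale (a * b) x.
Proof. by apply/fpsP => m /=; rewrite mulrA. Qed.
Lemma fps_scale1 : left_id 1 fps_scale.
Proof. by move=> x; apply/fpsP => m /=; rewrite mul1r. Qed.
Lemma fps_scaleDr : right_distributive fps_scale +%R.
Proof. by move=> a x y; apply/fpsP => m /=; rewrite mulrDr. Qed.
Lemma fps_scaleDl x : {morph fps_scale^~ x : a b / a + b}.
Proof. by move=> a b; apply/fpsP => m /=; rewrite mulrDl. Qed.
HB.instance Definition _ := GRing.Zmodule_isLmodule.Build K fps
  fps_scaleA fps_scale1 fps_scaleDr fps_scaleDl.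

Lemma fps_scaleAl (c : K) (x y : fps) : c *: (x * y) = (c *: x) * y.
Proof.
apply/fpsP => m /=; rewrite mulr_sumr.
by apply: eq_bigr => k _; rewrite mulrA.
Qed.
HB.instance Definition _ := GRing.Lmodule_isLalgebra.Build K fps fps_scaleAl.
HB.instance Definition _ := GRing.Lalgebra_isComAlgebra.Build K fps.

End FormalPowerSeries.

Section ConvergentPowerSeries.
Variables (n : nat) (R : realType).
Local Notation C := R[i].
Local Notation normc := ComplexField.Normc.normc.

Definition weight (r : R) (a : fps n C) (m : 'X_{1..n}) : R :=
  normc (fps_coef a m) * r ^+ mdeg m.

(* Absolute convergence on some closed polydisc centred at 0; shrinking a
   polyradius, one may take all its components equal to r. *)
Definition convergent (a : fps n C) : Prop :=
  exists2 r : R, 0 < r & summable [set: 'X_{1..n}] (fun m => (weight r a m)%:E).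

Lemma normc_ge0 (z : C) : 0 <= normc z.
Proof. by case: z => x y; exact: sqrtr_ge0. Qed.

Lemma weight_ge0 r a m : 0 < r -> 0 <= weight r a m.
Proof. by move=> r0; rewrite mulr_ge0 ?normc_ge0 ?exprn_ge0 ?ltW. Qed.

Lemma summable_boundedP (F : 'X_{1..n} -> R) : (forall m, 0 <= F m) ->
  summable [set: 'X_{1..n}] (fun m => (F m)%:E) <->
  exists M : R, forall d, \sum_(m : 'X_{1..n < d}) F m <= M.
Proof.
move=> F0.
have E d : (\sum_(m : 'X_{1..n < d}) F m)%:E =
    \sum_(m \in [set` [seq val k | k : 'X_{1..n < d}]]) `|(F m)%:E|%E.
  rewrite -fsbig_seq; last by rewrite map_inj_uniq ?enum_uniq//; exact: val_inj.
  rewrite big_map big_enum /= -sumEFin.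
  by apply: eq_bigr => m _; rewrite ger0_norm.
split=> [|[M FM]].
  rewrite summableE => Ffin.
  exists (fine (\esum_(m in [set: 'X_{1..n}]) `|(F m)%:E|%E)) => d.
  rewrite -lee_fin fineK// E; apply: ereal_sup_ubound.
  by exists [set` [seq val k | k : 'X_{1..n < d}]] => //; split=> //; exact: finite_seq.
rewrite /summable; apply: (@le_lt_trans _ _ M%:E); last exact: ltry.
apply: ge_ereal_sup => _ [X [finX _] <-].
have [d Xd] : exists d, forall m, X m -> (mdeg m < d)%N.
  exists (\max_(m <- fset_set X) mdeg m).+1 => m Xm; rewrite ltnS.
  by apply: leq_bigmax_seq => //; rewrite in_fset_set// mem_set.
apply: (@le_trans _ _ (\sum_(m : 'X_{1..n < d}) F m)%:E); last by rewrite lee_fin.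
rewrite E; apply: lee_fsum_nneg_subset => //; first exact: finite_seq.
move=> m /set_mem Xm; apply/mem_set; apply/mapP; exists (BMultinom (Xd m Xm)) => //.
by rewrite mem_enum.
Qed.

Lemma convergentP (a : fps n C) : convergent a <->
  exists r M : R, 0 < r /\ forall d, \sum_(m : 'X_{1..n < d}) weight r a m <= M.
Proof.
have w0 r (r0 : 0 < r) := fun m => weight_ge0 a m r0.
split=> [[r r0 /(summable_boundedP (w0 r r0))[M aM]]|[r [M [r0 aM]]]].
  by exists r, M.
by exists r => //; apply/(summable_boundedP (w0 r r0)); exists M.
Qed.

Lemma weight_sumW (a : fps n C) (r r' M : R) : 0 < r' <= r ->
  (forall d, \sum_(m : 'X_{1..n < d}) weight r a m <= M) ->
  forall d, \sum_(m : 'X_{1..n < d}) weight r' a m <= M.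
Proof.
move=> /andP[r'0 r'r] aM d; apply: le_trans (aM d); apply: ler_sum => m _.
by rewrite ler_wpM2l ?normc_ge0// lerXn2r// nnegrE ltW// (lt_le_trans r'0).
Qed.

Lemma convergent2P (a b : fps n C) : convergent a -> convergent b ->
  exists r M : R, [/\ 0 < r, 0 <= M,
    forall d, \sum_(m : 'X_{1..n < d}) weight r a m <= M &
    forall d, \sum_(m : 'X_{1..n < d}) weight r b m <= M].
Proof.
move=> /convergentP[r [M [r0 aM]]] /convergentP[s [N [s0 bN]]].
have t0 : 0 < Num.min r s by rewrite lt_min r0.
exists (Num.min r s), (Num.max 0 (Num.max M N)).
split=> // [|d|d]; first by rewrite le_max lexx.
- apply: (@le_trans _ _ M); last by rewrite !le_max lexx orbT.
  by apply: weight_sumW aM d; rewrite t0 ge_min lexx.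
- apply: (@le_trans _ _ N); last by rewrite !le_max lexx !orbT.
  by apply: weight_sumW bN d; rewrite t0 ge_min lexx orbT.
Qed.

Definition convergent_pred : pred (fps n C) := fun a => `[< convergent a >].

Lemma normc_sum (I : Type) (s : seq I) (P : pred I) (F : I -> C) :
  normc (\sum_(i <- s | P i) F i) <= \sum_(i <- s | P i) normc (F i).
Proof.
elim/big_ind2: _ => [|x y z t xy zt|//]; first by rewrite ComplexField.Normc.normc0.
by apply: le_trans (lerD xy zt); exact: le_normcD.
Qed.

Lemma sum_bm_le d (m : 'X_{1..n}) (c : R) : 0 <= c ->
  \sum_(k : 'X_{1..n < d} | (k : 'X_{1..n}) == m) c <= c.
Proof.
move=> c0; have [lt_d|ge_d] := ltnP (mdeg m) d.
  by rewrite (big_pred1 (BMultinom lt_d)).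
rewrite big_pred0// => k; apply: contraTF ge_d => /eqP <-.
by rewrite -ltnNge bmdeg.
Qed.

Lemma convergentM (a b : fps n C) : convergent a -> convergent b -> convergent (a * b).
Proof.
move=> ca cb; have [r [M [r0 M0 aM bM]]] := convergent2P ca cb.
apply/convergentP; exists r, (M * M); split=> // d.
apply: le_trans (ler_pM _ _ (aM d) (bM d));
  try by apply: sumr_ge0 => m _; exact: weight_ge0.
rewrite big_distrlr pair_big /=.
pose G (k : 'X_{1..n < d, d}) := weight r a k.1 * weight r b k.2.
have G0 k : 0 <= G k by rewrite mulr_ge0 ?weight_ge0.
apply: (@le_trans _ _ (\sum_(m : 'X_{1..n < d})
    \sum_(k : 'X_{1..n < d, d} | (m : 'X_{1..n}) == (k.1 + k.2)%MM) G k)).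
  apply: ler_sum => m _.
  have md := bmdeg m; rewrite /weight.
  have -> : fps_coef (a * b) m = \sum_(k : 'X_{1..n < d, d} |
      (m : 'X_{1..n}) == (k.1 + k.2)%MM) fps_coef a k.1 * fps_coef b k.2.
    rewrite [LHS](fps_mulE _ _ md) (mcoeff_poly_mul _ _ md).
    by apply: eq_bigr => k _; rewrite !fps_truncE ?bmdeg.
  apply: le_trans (ler_wpM2r _ (normc_sum _ _ _)) _.
    by rewrite exprn_ge0 ?ltW.
  rewrite mulr_suml; apply: ler_sum => k /eqP ->.
  by rewrite ComplexField.Normc.normcM mdegD exprD mulrACA.
rewrite (exchange_big_dep predT) //=; apply: ler_sum => k _.
exact: sum_bm_le.
Qed.

Lemma convergentD (a b : fps n C) : convergent a -> convergent b -> convergent (a + b).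
Proof.
move=> ca cb; have [r [M [r0 M0 aM bM]]] := convergent2P ca cb.
apply/convergentP; exists r, (M + M); split=> // d.
apply: le_trans (lerD (aM d) (bM d)); rewrite -big_split /=.
apply: ler_sum => m _; rewrite -mulrDl; apply: ler_wpM2r; first by rewrite exprn_ge0 ?ltW.
exact: le_normcD.
Qed.

Lemma convergentZ (c : C) (a : fps n C) : convergent a -> convergent (c *: a).
Proof.
move=> /convergentP[r [M [r0 aM]]]; apply/convergentP.
exists r, (normc c * M); split=> // d.
apply: le_trans (ler_wpM2l (normc_ge0 c) (aM d)); rewrite mulr_sumr.
by apply: ler_sum => m _; rewrite /weight /= ComplexField.Normc.normcM mulrA.
Qed.

Lemma convergent_poly (p : {mpoly C[n]}) : convergent (Fps (fun m => p@_m)).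
Proof.
apply/convergentP.
exists 1, (\sum_(m <- msupp p) normc p@_m); split=> // d.
apply: (@le_trans _ _ (\sum_(k : 'X_{1..n < d}) \sum_(m <- msupp p)
    if (k : 'X_{1..n}) == m then normc p@_m else 0)).
  apply: ler_sum => k _; rewrite /weight /= expr1n mulr1 -big_mkcond /=.
  have [kp|/memN_msupp_eq0 ->] := boolP ((k : 'X_{1..n}) \in msupp p).
    by rewrite (big_rem (k : 'X_{1..n})) //= eqxx lerDl sumr_ge0// => *; exact: normc_ge0.
  by rewrite ComplexField.Normc.normc0 sumr_ge0// => *; exact: normc_ge0.
rewrite exchange_big /=; apply: ler_sum => m _.
by rewrite -big_mkcond /= sum_bm_le// normc_ge0.
Qed.

Lemma convergent_subalg_closed : subalg_closed convergent_pred.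
Proof.
split.
- apply/asboolP; have := convergent_poly 1; congr convergent.
  by apply/fpsP => m /=; rewrite mcoeff1.
- move=> c a b /asboolP ca /asboolP cb; apply/asboolP/convergentD => //.
  exact: convergentZ.
- by move=> a b /asboolP ca /asboolP cb; apply/asboolP/convergentM.
Qed.

HB.instance Definition _ := GRing.isSubalgClosed.Build C (fps n C) convergent_pred
  convergent_subalg_closed.

Record cps := Cps { cps_val :> fps n C; _ : cps_val \in convergent_pred }.

HB.instance Definition _ := [isSub for cps_val].
HB.instance Definition _ := [Choice of cps by <:].
HB.instance Definition _ := [SubChoice_isSubComNzRing of cps by <:].
HB.instance Definition _ := [SubZmodule_isSubLmodule of cps by <:].
HB.instance Definition _ := [SubNzRing_SubLmodule_isSubLalgebra of cps by <:].
HB.instance Definition _ := [SubLalgebra_isSubAlgebra of cps by <:].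

Lemma cps_of_mpoly_subproof (p : {mpoly C[n]}) : Fps (fun m => p@_m) \in convergent_pred.
Proof. by apply/asboolP; exact: convergent_poly. Qed.

Definition cps_of_mpoly (p : {mpoly C[n]}) : cps := Cps (cps_of_mpoly_subproof p).

Lemma cps_of_mpoly_zmod : zmod_morphism cps_of_mpoly.
Proof. by move=> p q; apply/val_inj/fpsP => m; rewrite /= mcoeffB. Qed.
Lemma cps_of_mpoly_monoid : monoid_morphism cps_of_mpoly.
Proof.
by split=> [|p q]; apply/val_inj/fpsP => m; rewrite /= ?mcoeff1 ?mcoeffM.
Qed.
HB.instance Definition _ :=
  GRing.isZmodMorphism.Build {mpoly C[n]} cps cps_of_mpoly cps_of_mpoly_zmod.
HB.instance Definition _ :=
  GRing.isMonoidMorphism.Build {mpoly C[n]} cps cps_of_mpoly cps_of_mpoly_monoid.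

End ConvergentPowerSeries.

(* Main.v *)
From HB Require Import structures.
Require Import Defs.
From mathcomp Require Import all_boot all_order all_algebra.
From mathcomp Require Import complex mpoly.
From mathcomp Require Import boolp classical_sets reals.
From mathcomp Require Import ring.

Set Implicit Arguments.
Unset Strict Implicit.
Unset Printing Implicit Defensive.

Import Order.TTheory GRing.Theory Num.Theory ssrcomplements.
Local Open Scope classical_set_scope.
Local Open Scope ring_scope.

(** Write [A] for the polynomial ring in [n] variables over a field [K], [m] for
    the ideal of the origin, and let [b] be an ideal of [A] inside [m] whose
    quotient has Krull dimension zero.  Both quotients in the theorem are
    identified with [A / (b + m^N)] for one large [N], because a polynomial
    cannot tell the two local rings apart modulo a power of [m].

    The dimension hypothesis makes [m] minimal among the primes containing
    [b].  Hence every element of [m] is nilpotent in the local ring of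
    [Spec (A / b)] at the origin: otherwise some prime containing [b] would avoid
    all products [s x^k] with [s] outside [m], and would lie strictly inside [m]
    ([prime_avoiding], [krull_dim0_nilpotent]).  Applied to the variables, this
    gives one [s] outside [m] and one [N] with [s m^N] inside [b]
    ([krull_dim0_order_sub]).

    A morphism [phi : A -> B] is then compared with its source using three
    properties ([local_like]): [phi] inverts the polynomials outside [m], every
    element of [B] is a constant modulo [m B], and [m^N B] contracts to [m^N].
    They imply that [A -> B / b B] is onto, since [B = phi(A) + m^N B] by iterating
    the second property and [m^N B] lies in [b B] because [s] becomes a unit
    ([quot_ext_surj]); and that its kernel is [b + m^N] ([quot_ext_ker]).  As this
    kernel does not mention [B], two such morphisms have isomorphic quotients
    ([quot_iso_of_surj]).

    For the localization the three properties come from clearing denominators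
    ([loc_local_like]).  For convergent power series ([cps_local_like]) the analytic
    points are that a polynomial with nonzero constant term has a convergent
    inverse, obtained from a geometric series in a weighted l1 norm that is
    small on small polydiscs ([convergent_geom]), and that a convergent series
    without constant term is a combination of the variables with convergent
    coefficients ([cps_residue]). *)

(** * Generated and extended ideals *)

Lemma ideal_gen_sub (A : comPzRingType) (S : set A) x : S x -> x \in ideal_gen S.
Proof.
move=> Sx; apply/asboolP; exists 1%N, (fun=> 1), (fun=> x).
by split=> //; rewrite big_ord1 mul1r.
Qed.

Lemma ideal_gen_ind (A : comPzRingType) (S : set A) (Q : A -> Prop) :
  Q 0 -> (forall x y, Q x -> Q y -> Q (x + y)) ->
  (forall a s, S s -> Q (a * s)) -> forall x, x \in ideal_gen S -> Q x.
Proof.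
move=> Q0 QD QM x /asboolP[n [a [s [Ss ->]]]].
by apply: (big_ind Q) => // i _; exact: QM.
Qed.

Lemma ideal_ext_sub (A B : comPzRingType) (f : {rmorphism A -> B}) (I : ideal A) x :
  x \in I -> f x \in ideal_ext f I.
Proof. by move=> Ix; apply: ideal_gen_sub; exists x. Qed.

Lemma ideal_ext_ind (A B : comPzRingType) (f : {rmorphism A -> B}) (I : ideal A)
    (Q : B -> Prop) :
  Q 0 -> (forall x y, Q x -> Q y -> Q (x + y)) ->
  (forall a x, x \in I -> Q (a * f x)) -> forall z, z \in ideal_ext f I -> Q z.
Proof.
move=> Q0 QD QM; apply: ideal_gen_ind => // a _ [x Ix <-]; exact: QM.
Qed.

(** * Primes avoiding a multiplicative set *)

Section PrimeAvoidance.
Variables (A : comPzRingType) (I : ideal A) (T : set A).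
Hypotheses (T1 : T 1) (TM : forall x y, T x -> T y -> T (x * y)).
Hypothesis IT : forall x, x \in I -> ~ T x.

(* Ideals are handled as bare sets here so that the maximality principle for
   inclusion of sets applies. *)
Let avoiding (X : set A) : Prop :=
  [/\ {subset I <= [pred x | `[< X x >]]}, forall x y, X x -> X y -> X (x - y),
      forall a x, X x -> X (a * x) & forall x, X x -> ~ T x].

(** An ideal containing [I] that is maximal among those avoiding [T] is prime: if
    [x] and [y] are both outside it, adding either one produces an element of
    [T], and the product of these two elements would put [x * y] outside it. *)
Lemma prime_avoiding : exists P : spec A, {subset I <= P} /\ forall x, x \in P -> ~ T x.
Proof.
(* The union of the empty chain is empty, so the empty set is admitted; it is
   not maximal since [I] itself avoids [T]. *)
have [|X [+ Xmax]] := @Zorn_bigcup A (fun X => X = set0 \/ avoiding X).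
  move=> F FP Ftot.
  have [[X0 FX0 [x0 X0x0]]|/forall2NP F0] := pselect (exists2 X, F X & X !=set0); last first.
    left; rewrite bigcup0// => X FX; have [//|] := F0 X.
    by move/nonemptyPn.
  have Fa X x : F X -> X x -> avoiding X.
    by move=> FX Xx; have [X0'|//] := FP _ FX; rewrite X0' in Xx.
  right; split.
  - move=> x Ix; apply/asboolP; exists X0 => //.
    by have [h _ _ _] := Fa _ _ FX0 X0x0; exact/asboolP/h.
  - move=> x y [X FX Xx] [Y FY Yy].
    have [XY|YX] := Ftot _ _ FX FY.
      by exists Y => //; have [_ h _ _] := Fa _ _ FY Yy; apply: h => //; exact: XY.
    by exists X => //; have [_ h _ _] := Fa _ _ FX Xx; apply: h => //; exact: YX.
  - move=> a x [X FX Xx]; exists X => //.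
    by have [_ _ h _] := Fa _ _ FX Xx; exact: h.
  - by move=> x [X FX Xx]; have [_ _ _] := Fa _ _ FX Xx; exact.
have avI : avoiding [set x | x \in I].
  split=> [x Ix|x y|a x|x] /=; [exact/asboolP|exact: rpredB|exact: idealM|exact: IT].
case=> [X0|[XI XB XM XT]].
  case: (Xmax [set x | x \in I]); last by right.
  by rewrite X0; split=> // /(_ 0); apply; exact: rpred0.
have X0 : X 0 by apply/asboolP/XI/rpred0.
have XN x : X x -> X (- x) by rewrite -sub0r; exact: XB.
have XD x y : X x -> X y -> X (x + y).
  by move=> Xx /XN Xy; rewrite -[y]opprK; exact: XB.
have Xc x : ~ X x -> exists p a, X p /\ T (p + a * x).
  move=> NXx; apply: contrapT => NT.
  pose Y := [set z | exists p a, X p /\ z = p + a * x].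
  apply: (Xmax Y).
    split=> [p Xp|YX]; first by exists p, 0; rewrite mul0r addr0.
    by apply/NXx/YX; exists 0, 1; rewrite mul1r add0r.
  right; split.
  - move=> y /XI/asboolP Xy; apply/asboolP.
    by exists y, 0; rewrite mul0r addr0.
  - move=> _ _ [p [a [Xp ->]]] [q [c [Xq ->]]]; exists (p - q), (a - c).
    by split; [exact: XB|ring].
  - move=> c _ [p [a [Xp ->]]]; exists (c * p), (c * a).
    by split; [exact: XM|ring].
  - by move=> _ [p [a [Xp ->]]] Tz; apply: NT; exists p, a.
pose Xp : pred A := fun x => `[< X x >].
have Xz : zmod_closed Xp.
  split=> [|x y /asboolP Xx /asboolP Xy]; apply/asboolP => //; exact: XB.
have Xm a x : x \in Xp -> a * x \in Xp by move=> /asboolP Xx; apply/asboolP/XM.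
have Xprime : prime_ideal (Ideal Xz Xm).
  split=> [|x y]; first by apply/negP => /asboolP /XT.
  move=> /asboolP Xxy; have [Xx|/Xc[p [a [Xa Ta]]]] := pselect (X x).
    by left; apply/asboolP.
  have [Xy|/Xc[q [c [Xq Tc]]]] := pselect (X y); first by right; apply/asboolP.
  exfalso; apply: XT (TM Ta Tc).
  have -> : (p + a * x) * (q + c * y) = (q + c * y) * p + (a * x) * q + (a * c) * (x * y).
    by ring.
  by apply: (XD _ _ (XD _ _ _ _)); exact: XM.
exists (Spec Xprime); split=> x; first exact: XI.
by move=> /asboolP/XT.
Qed.
End PrimeAvoidance.

(** * Quotients of Krull dimension zero *)

Section QuotientSpectrum.
Variables (A : comPzRingType) (b : ideal A).
Local Notation pi := (\pi_(quot b))%qT.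

Lemma pi_quotD x y : pi (x + y) = pi x + pi y.
Proof. exact: pi_quot_add. Qed.
Lemma pi_quotM x y : pi (x * y) = pi x * pi y.
Proof. exact: pi_quot_mul. Qed.
Lemma pi_quot1 : pi 1 = 1.
Proof. by rewrite [RHS]piE. Qed.
Lemma pi_quotB x y : pi (x - y) = pi x - pi y.
Proof.
by rewrite pi_quotD; congr (_ + _); exact: (@Quotient.pi_opp A b).
Qed.
Lemma pi_quot0 : pi 0 = 0.
Proof. by rewrite -(subrr 0) pi_quotB subrr. Qed.

Variables (P : spec A) (bP : {subset b <= P}).

Definition quot_prime_pred : pred (quot b) := fun x => repr x \in P.

Lemma quot_primeE x : (pi x \in quot_prime_pred) = (x \in P).
Proof.
rewrite -[RHS]/(x \in ideal_pred P) -[LHS]/(repr (pi x) \in ideal_pred P).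
have xP : repr (pi x) - x \in P by apply/bP/quot_eqP; rewrite reprK.
by rewrite -{1}(subrK x (repr (pi x))) (rpredDl _ xP).
Qed.

Lemma quot_prime_zmod : zmod_closed quot_prime_pred.
Proof.
split=> [|x y]; first by rewrite -pi_quot0 quot_primeE rpred0.
rewrite -[x]reprK -[y]reprK -pi_quotB !quot_primeE; exact: rpredB.
Qed.

Lemma quot_primeM a x : x \in quot_prime_pred -> a * x \in quot_prime_pred.
Proof. rewrite -[x]reprK -[a]reprK -pi_quotM !quot_primeE; exact: idealM. Qed.

Lemma quot_prime_prime : prime_ideal (Ideal quot_prime_zmod quot_primeM).
Proof.
split=> [|x y]; first by rewrite -pi_quot1 quot_primeE (specP P).1.
by rewrite -[x]reprK -[y]reprK -pi_quotM !quot_primeE; exact: (specP P).2.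
Qed.

Definition quot_prime : spec (quot b) := Spec quot_prime_prime.

End QuotientSpectrum.

(** Otherwise the images of [P] and [Q] would form a chain of length one in the
    spectrum of the quotient. *)
Lemma krull_dim0_maximal (A : comPzRingType) (b : ideal A) (P Q : spec A) :
  krull_dim_is (quot b) 0 -> {subset b <= P} -> {subset P <= Q} -> {subset Q <= P}.
Proof.
move=> [_ dim0] bP PQ; apply: contrapT => NQP.
have bQ : {subset b <= Q} by move=> x /bP/PQ.
pose p (i : 'I_2) := if i == ord0 then quot_prime bP else quot_prime bQ.
suff /dim0 : prime_chain p by [].
move=> i j; rewrite /p; case: (altP (i =P ord0)) => [->|i0]; last first.
  by case: i i0 => -[|[]]// ? _; case: j => -[|[]].
case: (altP (j =P ord0)) => [->//|j0 _]; split=> [x|h].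
  by rewrite -[x]reprK /= (quot_primeE bP) (quot_primeE bQ); exact: PQ.
by apply: NQP => x; rewrite -(quot_primeE bQ) => /h; rewrite (quot_primeE bP).
Qed.

(** This says that [x] is nilpotent in the localization at [Q] of [A / b], whose
    only prime is the maximal one.  If it failed, a prime containing [b] and
    avoiding every [s * x ^+ k] with [s] outside [Q] would lie inside [Q] without
    containing [x]. *)
Lemma krull_dim0_nilpotent (A : comPzRingType) (b : ideal A) (Q : spec A) x :
  krull_dim_is (quot b) 0 -> {subset b <= Q} -> x \in Q ->
  exists s k, s \notin Q /\ s * x ^+ k \in b.
Proof.
move=> dim0 bQ xQ; apply: contrapT => N.
pose T := [set y | exists s k, s \notin Q /\ y = s * x ^+ k].
have [|||P [bP PT]] := @prime_avoiding A b T.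
- by exists 1, 0%N; rewrite expr0 mulr1 (specP Q).1.
- move=> _ _ [s [k [Qs ->]]] [t [l [Qt ->]]]; exists (s * t), (k + l)%N; split.
    by apply/negP => /(specP Q).2[] h; [rewrite h in Qs|rewrite h in Qt].
  by rewrite exprD; ring.
- by move=> y yb [s [k [Qs yE]]]; apply: N; exists s, k; rewrite -yE.
have PQ : {subset P <= Q}.
  move=> s Ps; apply: contrapT => /negP Qs; apply: PT Ps _.
  by exists s, 0%N; rewrite expr0 mulr1.
apply: (PT x (krull_dim0_maximal dim0 bP PQ xQ)).
by exists 1, 1%N; rewrite expr1 mul1r (specP Q).1.
Qed.

(** * The powers of the ideal of the origin *)

Section OrderIdeal.
Variables (n : nat) (K : fieldType).
Implicit Types (f g s : {mpoly K[n]}).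

Definition order_pred N : pred {mpoly K[n]} :=
  fun f => `[< forall m, (mdeg m < N)%N -> f@_m = 0 >].

Lemma order_predM i j f g :
  f \in order_pred i -> g \in order_pred j -> f * g \in order_pred (i + j).
Proof.
move=> /asboolP f0 /asboolP g0; apply/asboolP => m mij.
rewrite mcoeffM big1// => -[k l] /= /eqP mE.
have [ki|ik] := ltnP (mdeg k) i; first by rewrite f0 ?mul0r.
rewrite g0 ?mulr0//; rewrite ltnNge; apply: contraTN mij => jl.
by rewrite -leqNgt (congr1 mdeg mE) mdegD leq_add.
Qed.

Lemma order_pred0 f : f \in order_pred 0.
Proof. by apply/asboolP. Qed.

Lemma order_pred_zmod N : zmod_closed (order_pred N).
Proof.
split=> [|f g /asboolP f0 /asboolP g0]; apply/asboolP => m mN; first by rewrite mcoeff0.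
by rewrite mcoeffB f0 ?g0 ?subr0.
Qed.

Lemma order_predMl N f g : g \in order_pred N -> f * g \in order_pred N.
Proof. exact: (order_predM (order_pred0 f)). Qed.

(** The [N]-th power of the ideal of the origin, described by vanishing
    coefficients rather than by products of generators. *)
Definition order_ideal N : ideal {mpoly K[n]} :=
  Ideal (order_pred_zmod N) (@order_predMl N).

Lemma order_idealP N f :
  reflect (forall m, (mdeg m < N)%N -> f@_m = 0) (f \in order_ideal N).
Proof. exact: asboolP. Qed.

Lemma order_idealM i j f g :
  f \in order_ideal i -> g \in order_ideal j -> f * g \in order_ideal (i + j).
Proof. exact: order_predM. Qed.

Lemma in_origin f : (f \in origin n K) = (f@_0%MM == 0).
Proof. exact: origin_idealP. Qed.

Lemma origin_order1 f : (f \in origin n K) = (f \in order_ideal 1).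
Proof.
rewrite in_origin; apply/eqP/order_idealP => [f0 m|->//].
  by rewrite ltnS leqn0 mdeg_eq0 => /eqP->.
by rewrite mdeg0.
Qed.

(** The powers of the ideal of the origin are primary: write [s = c + h] with
    [c] a nonzero constant and [h] of order at least 1.  If [f] has order at least
    [k < N], then [c * f = s * f - h * f] has order at least [k + 1]. *)
Lemma order_ideal_cancel N s f :
  s \notin origin n K -> s * f \in order_ideal N -> f \in order_ideal N.
Proof.
move=> Ks sf; have s0 : s@_0%MM != 0 by rewrite -in_origin.
suff H k : (k <= N)%N -> f \in order_ideal k by exact: H.
elim: k => [|k IH] kN; first exact: order_pred0.
have nf : (s - (s@_0%MM)%:MP) * f \in order_ideal k.+1.
  rewrite -add1n; apply: order_idealM; last exact/IH/ltnW.
  by rewrite -origin_order1 in_origin mcoeffB mcoeffC eqxx mulr1 subrr.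
have sfk : s * f \in order_ideal k.+1.
  apply/order_idealP => m mk; apply: (order_idealP _ _ sf); exact: leq_trans kN.
have -> : f = (s@_0%MM)^-1%:MP * (s * f - (s - (s@_0%MM)%:MP) * f).
  rewrite mulrBl opprB addrC subrK mulrA -mpolyCM mulVf// mpolyC1 mul1r //.
by apply/idealM/rpredB.
Qed.

(** By the pigeonhole principle, a monomial of degree larger than [n * k] is
    divisible by the [k]-th power of some variable.  The strict inequality also
    covers [n = 0]. *)
Lemma order_ideal_sub (I : ideal {mpoly K[n]}) s k N :
  (forall i, s * 'X_i ^+ k \in I) -> (n * k < N)%N ->
  forall f, f \in order_ideal N -> s * f \in I.
Proof.
move=> sI nkN f fN; rewrite [f]mpolyE mulr_sumr; apply: rpred_sum => m _.
have [mN|Nm] := ltnP (mdeg m) N.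
  by rewrite (order_idealP _ _ fN)// scale0r mulr0 rpred0.
have [i ki] : exists i, (k <= m i)%N.
  apply: contrapT => /forallNP h; move: Nm; apply/negP; rewrite -ltnNge.
  apply: leq_ltn_trans nkN; rewrite mdegE.
  apply: (@leq_trans (\sum_(j < n) k)%N); last by rewrite sum_nat_const card_ord.
  by apply: leq_sum => i _; apply/ltnW; rewrite ltnNge; exact/negP.
have -> : 'X_[m] = 'X_[m - U_(i) *+ k]%MM * 'X_i ^+ k :> {mpoly K[n]}.
  rewrite mpolyXn -mpolyXD submK//; apply/mnm_lepP => j.
  by rewrite mulmnE mnm1E; case: eqP => [<-|_]; rewrite ?mul1n.
by rewrite -mul_mpolyC mulrCA (mulrCA s); do 2!apply: idealM.
Qed.

End OrderIdeal.
Arguments order_ideal {n K} N.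

(** Each variable is nilpotent in the local ring of the quotient at the origin;
    the product of the multipliers and the largest exponent serve them all. *)
Lemma krull_dim0_order_sub (n : nat) (K : fieldType) (b : ideal {mpoly K[n]}) :
  krull_dim_is (quot b) 0 -> zero_locus b (origin n K) ->
  exists s N, s \notin origin n K /\ forall f, f \in order_ideal N -> s * f \in b.
Proof.
move=> dim0 bO.
have /choice[u uP] (i : 'I_n) : exists u : {mpoly K[n]} * nat,
    u.1 \notin origin n K /\ u.1 * 'X_i ^+ u.2 \in b.
  have [|s [k sk]] := @krull_dim0_nilpotent _ b (origin n K) 'X_i dim0 bO.
    by rewrite in_origin mcoeffX mnm1_eq0.
  by exists (s, k).
exists (\prod_i (u i).1), (n * \max_i (u i).2).+1; split.
  elim/big_rec: _ => [|i s _ Ns]; first exact: (specP (origin n K)).1.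
  by apply: spec_mulN => //; exact: (uP i).1.
apply: order_ideal_sub => // i.
rewrite (bigD1 i)//= -(subnK (leq_bigmax i)) exprD.
by rewrite [(u i).1 * _]mulrC mulrACA; apply/idealM/(uP i).2.
Qed.

(** * Comparing a local ring with polynomials *)

Section Comparison.
Variables (n : nat) (K : fieldType) (B : comPzRingType).
Variable phi : {rmorphism {mpoly K[n]} -> B}.

(** What the localization at the origin and the convergent power series have
    in common: [B] behaves like a local ring with the residue field and the
    infinitesimal neighbourhoods of the origin of affine space. *)
Record local_like : Prop := LocalLike {
  local_like_unit : forall s, s \notin origin n K -> exists u, u * phi s = 1;
  local_like_residue : forall z,
    exists c : K, z - phi c%:MP \in ideal_ext phi (origin n K);
  local_like_order : forall N f,
    phi f \in ideal_ext phi (order_ideal N) -> f \in order_ideal N }.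

Hypothesis phiL : local_like.

(** Induction on [N]: an element of [m^N B] is a sum of terms [a * phi f] with
    [f] in [m^N], and replacing each [a] by its residue constant costs an error
    in [m^N.+1 B]. *)
Lemma local_like_approx N z :
  exists p, z - phi p \in ideal_ext phi (order_ideal N).
Proof.
elim: N z => [|N IH] z.
  exists 0; rewrite -[X in X \in _]mulr1 -(rmorph1 phi); apply: idealM.
  apply: ideal_ext_sub; exact: order_pred0.
have [p zp] := IH z.
suff [q zq] : exists q, (z - phi p) - phi q \in ideal_ext phi (order_ideal N.+1).
  by exists (p + q); rewrite rmorphD opprD addrA.
move: (z - phi p) zp; apply: ideal_ext_ind => [|x y [p1 xp] [p2 yp]|a f fN].
- by exists 0; rewrite rmorph0 subr0 rpred0.
- exists (p1 + p2); rewrite rmorphD opprD addrACA; exact: rpredD.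
have [c] := local_like_residue phiL a.
move=> ac; exists (c%:MP * f); rewrite rmorphM -mulrBl.
move: (a - _) ac; apply: ideal_ext_ind => [|x y xI yI|d h hO].
- by rewrite mul0r rpred0.
- by rewrite mulrDl rpredD.
- rewrite -mulrA -rmorphM idealM// ideal_ext_sub// -add1n order_idealM//.
  by rewrite -origin_order1.
Qed.

Variables (b : ideal {mpoly K[n]}) (s0 : {mpoly K[n]}) (N : nat).
Hypothesis Os0 : s0 \notin origin n K.
Hypothesis s0b : forall f, f \in order_ideal N -> s0 * f \in b.

(** [phi s0] is a unit of [B], so [s0 * f] in [b] puts [phi f] in [b B]. *)
Lemma ext_order_sub : {subset ideal_ext phi (order_ideal N) <= ideal_ext phi b}.
Proof.
apply: ideal_ext_ind => [|x y|a f /s0b sfb]; [exact: rpred0|exact: rpredD|].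
have [u us] := local_like_unit phiL Os0.
by rewrite idealM// -[phi f]mul1r -us -mulrA -rmorphM idealM// ideal_ext_sub.
Qed.

Lemma quot_ext_surj (x : quot (ideal_ext phi b)) :
  exists p, (\pi_(quot (ideal_ext phi b)) (phi p))%qT = x.
Proof.
have [p xp] := local_like_approx N (repr x).
exists p; rewrite -[RHS]reprK; apply/esym/quot_eqP.
exact: ext_order_sub.
Qed.

(** The right-hand side does not involve [B].  For the direct implication, the
    coefficients of an element of [b B] are approximated by polynomials modulo
    [m^N B], and the resulting error contracts to [m^N]. *)
Lemma quot_ext_ker f : phi f \in ideal_ext phi b <->
  exists2 h, h \in b & f - h \in order_ideal N.
Proof.
split=> [fb|[h hb fh]]; last first.
  rewrite -(subrK h f) rmorphD; apply: rpredD; last exact: ideal_ext_sub.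
  by apply/ext_order_sub/ideal_ext_sub.
suff [h hb] : exists2 h, h \in b & phi f - phi h \in ideal_ext phi (order_ideal N).
  by rewrite -rmorphB => /(local_like_order phiL); exists h.
move: (phi f) fb; apply: ideal_ext_ind => [|x y [p pb xp] [q qb yq]|a g gb].
- by exists 0; rewrite ?rmorph0 ?subr0 ?rpred0.
- exists (p + q); first exact: rpredD.
  by rewrite rmorphD opprD addrACA rpredD.
- have [p ap] := local_like_approx N a; exists (p * g); first exact: idealM.
  by rewrite rmorphM -mulrBl mulrC idealM.
Qed.

End Comparison.

(** Both quotients are the quotient of [A] by the common kernel of the two
    surjections; the isomorphism lifts a class to [A] and maps it down again. *)
Lemma quot_iso_of_surj (K : comNzRingType) (A : comPzRingType)
    (B1 B2 : comAlgType K) (I1 : ideal B1) (I2 : ideal B2) (scaleA : K -> A -> A)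
    (f1 : {rmorphism A -> B1}) (f2 : {rmorphism A -> B2}) :
  (forall c x, f1 (scaleA c x) = c *: f1 x) ->
  (forall c x, f2 (scaleA c x) = c *: f2 x) ->
  (forall x : quot I1, exists p, (\pi_(quot I1) (f1 p))%qT = x) ->
  (forall x : quot I2, exists p, (\pi_(quot I2) (f2 p))%qT = x) ->
  (forall a, f1 a \in I1 <-> f2 a \in I2) ->
  exists f : {rmorphism quot I1 -> quot I2}, scalable f /\ bijective f.
Proof.
move=> f1Z f2Z /choice[r1 r1K] /choice[r2 r2K] I12.
pose f x := (\pi_(quot I2) (f2 (r1 x)))%qT.
pose g x := (\pi_(quot I1) (f1 (r2 x)))%qT.
have fE a : f (\pi_(quot I1) (f1 a))%qT = (\pi_(quot I2) (f2 a))%qT.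
  by apply/quot_eqP; rewrite -rmorphB -I12 rmorphB; apply/quot_eqP/r1K.
have gE a : g (\pi_(quot I2) (f2 a))%qT = (\pi_(quot I1) (f1 a))%qT.
  by apply/quot_eqP; rewrite -rmorphB I12 rmorphB; apply/quot_eqP/r2K.
have fB : zmod_morphism f.
  by move=> x y; rewrite -(r1K x) -(r1K y) -pi_quotB -rmorphB !fE rmorphB pi_quotB.
have fM : monoid_morphism f.
  split; first by rewrite -pi_quot1 -(rmorph1 f1) fE rmorph1 pi_quot1.
  by move=> x y; rewrite -(r1K x) -(r1K y) -pi_quotM -rmorphM !fE rmorphM pi_quotM.
pose fA := GRing.isZmodMorphism.Build _ _ f fB.
pose fR := GRing.isMonoidMorphism.Build _ _ f fM.
pose F : {rmorphism quot I1 -> quot I2} := HB.pack f fA fR.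
exists F; split=> [c x|].
  rewrite -(r1K x) -[_ *: _]pi_quot_scale -f1Z /= !fE f2Z.
  exact: pi_quot_scale.
by exists g => x; [rewrite -(r1K x) /= fE gE|rewrite -(r2K x) /= gE fE].
Qed.

(** * The localization at the origin *)

Section LocalizationLocalLike.
Variables (n : nat) (K : fieldType).
Local Notation phi := (@to_loc_mpoly n K).
Local Notation O := (origin n K).

Lemma to_loc_mpolyZ (c : K) p : phi (c *: p) = c *: phi p.
Proof. by rewrite -mul_mpolyC rmorphM. Qed.

Lemma to_loc_mpoly_inj : injective phi.
Proof. by move=> f g /(congr1 val)/eqP; rewrite /= tofrac_eq => /eqP. Qed.

Lemma loc_inverse s : s \notin O -> exists u, u * phi s = 1.
Proof.
move=> Os; have sP : (tofrac s)^-1 \in loc_pred O.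
  by apply/asboolP; exists 1, s; rewrite tofrac1 div1r.
exists (Localization sP : loc_mpoly n K); apply: val_inj => /=.
by rewrite mulVf// (spec_neq0 Os).
Qed.

Lemma loc_denominator (z : loc_mpoly n K) :
  exists s f, s \notin O /\ phi s * z = phi f.
Proof.
case: z => z zP; have /asboolP[f [s [Os zE]]] := zP.
exists s, f; split=> //; apply: val_inj => /=.
by rewrite zE mulrC divfK// (spec_neq0 Os).
Qed.

(** Clearing denominators reduces each property to polynomials; the contraction
    of [m^N] is then [order_ideal_cancel]. *)
Lemma loc_local_like : local_like phi.
Proof.
split=> [|z|N f].
- exact: loc_inverse.
- have [s [f [Os sz]]] := loc_denominator z; have [u us] := loc_inverse Os.
  have s0 : s@_0%MM != 0 by rewrite -in_origin.
  (* The residue of [f / s] is its value at the origin. *)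
  exists (f@_0%MM / s@_0%MM).
  rewrite -[z - _]mul1r -us -mulrA mulrBr sz -rmorphM -rmorphB.
  apply/idealM/ideal_ext_sub.
  by rewrite in_origin mcoeffB mcoeff0M mcoeffC eqxx mulr1 mulrC divfK// subrr.
- (* Unlike membership in the image of [m^N], membership up to a denominator
     is stable under sums and multiples. *)
  suff H z : z \in ideal_ext phi (order_ideal N) ->
      exists s g, [/\ s \notin O, g \in order_ideal N & phi s * z = phi g].
    move=> /H[s [g [Os gN]]]; rewrite -rmorphM => /to_loc_mpoly_inj sfg.
    by apply: order_ideal_cancel Os _; rewrite sfg.
  move: z; apply: ideal_ext_ind => [|x y [s [g [Os gN sx]]] [t [h [Ot hN ty]]]|a g gN].
  + exists 1, 0; rewrite mulr0 rmorph0 rpred0; split=> //; exact: (specP O).1.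
  + exists (s * t), (t * g + s * h); split; first exact: spec_mulN.
      by rewrite rpredD// idealM.
    by rewrite rmorphD !rmorphM /= -sx -ty; ring.
  + have [s [h [Os sa]]] := loc_denominator a.
    by exists s, (h * g); rewrite idealM// mulrA sa rmorphM.
Qed.

End LocalizationLocalLike.

(** * The inverse of a polynomial as a convergent series *)

Section WeightedNorm.
Variables (n : nat) (R : realType).
Local Notation C := R[i].
Local Notation normc := ComplexField.Normc.normc.
Implicit Types (p q : {mpoly C[n]}) (r : R).

(** The l1 norm of the coefficients of [p] on the closed polydisc of radius [r]. *)
Definition wnorm r p : R := \sum_(m <- msupp p) normc p@_m * r ^+ mdeg m.

Lemma sum_bm_msupp r p d :
  \sum_(m : 'X_{1..n < d}) normc p@_m * r ^+ mdeg m =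
  \sum_(m <- msupp p | (mdeg m < d)%N) normc p@_m * r ^+ mdeg m.
Proof.
rewrite (@big_mksub_cond _ _ _ _ _ 'X_{1..n < d}) ?msupp_uniq//=.
rewrite [RHS]big_mkcond; apply: eq_bigr => m _; rewrite bmdeg /=.
by case: ifPn => // /memN_msupp_eq0 ->; rewrite ComplexField.Normc.normc0 mul0r.
Qed.

Lemma wnormE r p d : (msize p <= d)%N ->
  wnorm r p = \sum_(m : 'X_{1..n < d}) normc p@_m * r ^+ mdeg m.
Proof.
move=> pd; rewrite sum_bm_msupp [RHS]big_seq_cond [LHS]big_seq_cond.
apply: eq_bigl => m; rewrite andbT; have [mp|//] := boolP (m \in msupp p).
by rewrite (leq_trans (msize_mdeg_lt mp)).
Qed.

Lemma wnorm_ge_trunc r p d : 0 <= r ->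
  \sum_(m : 'X_{1..n < d}) normc p@_m * r ^+ mdeg m <= wnorm r p.
Proof.
move=> r0; rewrite sum_bm_msupp big_mkcond; apply: ler_sum => m _.
by case: ifP => // _; rewrite mulr_ge0 ?normc_ge0 ?exprn_ge0.
Qed.

Lemma wnorm0 r : wnorm r 0 = 0.
Proof. by rewrite /wnorm msupp0 big_nil. Qed.

Lemma wnorm_ge0 r p : 0 <= r -> 0 <= wnorm r p.
Proof. by move=> r0; apply: sumr_ge0 => m _; rewrite mulr_ge0 ?normc_ge0 ?exprn_ge0. Qed.

Lemma wnormD r p q : 0 <= r -> wnorm r (p + q) <= wnorm r p + wnorm r q.
Proof.
move=> r0; pose d := maxn (msize p) (msize q).
rewrite (@wnormE r (p + q) d) ?msizeD_le// (@wnormE r p d) ?leq_maxl//.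
rewrite (@wnormE r q d) ?leq_maxr// -big_split; apply: ler_sum => m _.
by rewrite -[leRHS]/(_ * _ + _ * _) -mulrDl ler_wpM2r ?exprn_ge0// mcoeffD le_normcD.
Qed.

Lemma wnorm_monomial r c m : 0 <= r -> wnorm r (c *: 'X_[m]) = normc c * r ^+ mdeg m.
Proof.
move=> r0; have [->|c0] := eqVneq c 0.
  by rewrite scale0r wnorm0 ComplexField.Normc.normc0 mul0r.
by rewrite /wnorm msuppMCX// big_seq1 mcoeffZ mcoeffX eqxx mulr1.
Qed.

Lemma wnormM r p q : 0 <= r -> wnorm r (p * q) <= wnorm r p * wnorm r q.
Proof.
move=> r0; rewrite mpolyME big_allpairs big_distrlr /=.
elim/big_ind2: _ => [|x X y Y xX yY|m _]; first by rewrite wnorm0.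
  by apply: le_trans (wnormD _ _ r0) _; exact: lerD.
elim/big_ind2: _ => [|x X y Y xX yY|k _]; first by rewrite wnorm0.
  by apply: le_trans (wnormD _ _ r0) _; exact: lerD.
by rewrite wnorm_monomial// ComplexField.Normc.normcM mdegD exprD mulrACA.
Qed.

(** Without constant term, every monomial carries at least one factor [r]: this
    is what makes the norm small on small polydiscs. *)
Lemma wnorm_order1 r q : q \in order_ideal 1 -> 0 <= r <= 1 ->
  wnorm r q <= r * wnorm 1 q.
Proof.
move=> /order_idealP q0 /andP[r0 r1]; rewrite mulr_sumr; apply: ler_sum => m _.
rewrite expr1n mulr1 mulrC; have [/q0->|m0] := ltnP (mdeg m) 1.
  by rewrite ComplexField.Normc.normc0 !mulr0.
by rewrite ler_wpM2r ?normc_ge0// ler_iXnr.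
Qed.

Definition geom q d : {mpoly C[n]} := \sum_(k < d) q ^+ k.

Lemma geomS q d : geom q d.+1 = 1 + q * geom q d.
Proof.
rewrite /geom big_ord_recl expr0 mulr_sumr; congr (_ + _).
by apply: eq_bigr => k _; rewrite exprS.
Qed.

(** The recursion [geomS] keeps the bound, as [1 + 2^-1 * 2 = 2]. *)
Lemma wnorm_geom r q d : 0 <= r -> wnorm r q <= 2^-1 -> wnorm r (geom q d) <= 2.
Proof.
move=> r0 qr; elim: d => [|d IH]; first by rewrite /geom big_ord0 wnorm0.
rewrite geomS; apply: le_trans (wnormD _ _ r0) _.
have -> : 2 = 1 + 2^-1 * 2 :> R by rewrite mulVf ?pnatr_eq0.
apply: lerD.
  rewrite -[1]scale1r -mpolyX0 wnorm_monomial// mdeg0 expr0 mulr1.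
  by rewrite ComplexField.Normc.normc1.
by apply: le_trans (wnormM _ _ r0) _; rewrite ler_pM// wnorm_ge0.
Qed.

Lemma expr_order q k : q \in order_ideal 1 -> q ^+ k \in order_ideal k.
Proof.
move=> q1; elim: k => [|k IH]; first exact: order_pred0.
by rewrite exprS -add1n order_idealM.
Qed.

(** The powers of [q] contribute only in ever higher degrees, so each
    coefficient of the partial sums is eventually constant. *)
Lemma geom_coef q d m : q \in order_ideal 1 -> (mdeg m < d)%N ->
  (geom q d)@_m = (geom q (mdeg m).+1)@_m.
Proof.
move=> q1; elim: d => // d IH; rewrite ltnS leq_eqVlt => /predU1P[->//|md].
rewrite /geom big_ord_recr mcoeffD /= -/(geom q d) IH//.
by rewrite (order_idealP _ _ (expr_order d q1))// addr0.
Qed.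

Lemma geomM q d : (1 - q) * geom q d = 1 - q ^+ d.
Proof. by rewrite -[RHS]opprB subrX1 -mulNr opprB. Qed.

(** The sum of all powers of [q], provided that [q] has no constant term. *)
Definition geom_series q : fps n C := Fps (fun m => (geom q (mdeg m).+1)@_m).

(** On a polydisc small enough for [q] to have norm at most [2^-1], all the partial
    sums of the geometric series have norm at most 2. *)
Lemma convergent_geom q : q \in order_ideal 1 -> convergent (geom_series q).
Proof.
(* This radius makes [r * wnorm 1 q] at most [2^-1]; the summand 1 keeps the
   denominator positive and [r] at most 1. *)
move=> q1; pose W := wnorm 1 q; pose r := (2 * (1 + W))^-1.
have W0 : 0 <= W by exact: wnorm_ge0.
have W1 : 0 < 1 + W by rewrite ltr_wpDr.
have r0 : 0 < r by rewrite invr_gt0 mulr_gt0.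
have rW : r * (1 + W) = 2^-1 by rewrite /r invfM -mulrA mulVf ?mulr1// gt_eqF.
have r1 : r <= 1.
  apply: (@le_trans _ _ 2^-1); last by rewrite invf_le1// ler1n.
  by rewrite -rW ler_pMr// lerDl.
have qr : wnorm r q <= 2^-1.
  apply: le_trans (wnorm_order1 q1 _) _; first by rewrite r1 ltW.
  by rewrite -rW ler_pM2l// lerDr.
apply/convergentP; exists r, 2; split=> // d.
apply: le_trans (wnorm_geom d (ltW r0) qr).
apply: le_trans (wnorm_ge_trunc _ _ (ltW r0)).
by apply: ler_sum => m _; rewrite /weight /= -(geom_coef q1 (bmdeg m)).
Qed.

End WeightedNorm.

(** * Convergent power series *)

Section ConvergentLocalLike.
Variables (n : nat) (R : realType).
Local Notation C := R[i].
Local Notation phi := (@cps_of_mpoly n R).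
Local Notation normc := ComplexField.Normc.normc.
Local Notation O := (origin n C).

Lemma cps_of_mpolyZ (c : C) p : phi (c *: p) = c *: phi p.
Proof. by apply/val_inj/fpsP => m; rewrite /= mcoeffZ. Qed.

Lemma cps_mul_coef (a : cps n R) p m d : (mdeg m < d)%N ->
  fps_coef (a * phi p : cps n R) m = (fps_trunc d a * p)@_m.
Proof.
move=> md; rewrite [LHS](fps_mulE _ _ md); apply: (eq_mcoeffM md) => // k kd.
by rewrite fps_truncE.
Qed.

(** Divide [s] by its constant term [c] and expand [1 / (1 - q)] with
    [q = 1 - s / c]. *)
Lemma cps_inverse s : s \notin O -> exists u, u * phi s = 1.
Proof.
rewrite in_origin => s0; pose c := s@_0%MM; pose q := 1 - c^-1 *: s.
have q1 : q \in order_ideal 1.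
  by rewrite -origin_order1 in_origin mcoeffB mcoeff1 eqxx mcoeffZ mulVf// subrr.
have vP : geom_series q \in @convergent_pred n R by apply/asboolP/convergent_geom.
suff H : Cps vP * phi (c^-1 *: s) = 1.
  by exists (Cps vP * phi c^-1%:MP); rewrite -mulrA -rmorphM mul_mpolyC.
apply/val_inj/fpsP => m; have md := ltnSn (mdeg m).
rewrite (cps_mul_coef _ _ md); transitivity (geom q (mdeg m).+1 * (1 - q))@_m.
  apply: (eq_mcoeffM md) => k kd; last by rewrite /q opprB addrC subrK.
  by rewrite fps_truncE//= -(geom_coef q1 kd).
rewrite mulrC geomM mcoeffB mcoeff1 (order_idealP _ _ (expr_order _ q1))//.
by rewrite subr0.
Qed.

Lemma cps_order N z : z \in ideal_ext phi (order_ideal N) ->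
  forall m, (mdeg m < N)%N -> fps_coef z m = 0.
Proof.
move: z; apply: ideal_ext_ind => [//|x y x0 y0 m mN|a f fN m mN].
  by rewrite /= x0 ?y0 ?addr0.
rewrite (cps_mul_coef _ _ (ltnSn _)).
by have /order_idealP -> := idealM (fps_trunc (mdeg m).+1 a) fN.
Qed.

Definition pick_var (m : 'X_{1..n}) := [pick i | m i != 0%N].

(** The monomials of [a] divisible by some variable are distributed among the
    variables, each going to the one that [pick_var] selects; this is [a]
    restricted to the share of ['X_i], divided by ['X_i].  Hence [a] minus its
    constant term is the sum of the [fps_quotX i a * 'X_i]. *)
Definition fps_quotX (i : 'I_n) (a : fps n C) : fps n C := Fps (fun m =>
  if pick_var (m + U_(i))%MM == Some i then fps_coef a (m + U_(i))%MM else 0).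

(** Same radius: multiplying by ['X_i] embeds the monomials of the quotient into
    those of [a], one degree higher, which accounts for a factor [r^-1]. *)
Lemma convergent_quotX i a : convergent a -> convergent (fps_quotX i a).
Proof.
move=> /convergentP[r [M [r0 aM]]]; apply/convergentP.
exists r, (r^-1 * M); split=> // d; rewrite ler_pdivlMl// mulr_sumr.
have shP (m : 'X_{1..n < d}) : (mdeg (m + U_(i))%MM < d.+1)%N.
  by rewrite mdegD mdeg1 addn1 ltnS bmdeg.
pose sh m := BMultinom (shP m).
have sh_inj : injective sh.
  move=> m k /(congr1 val) /= /(congr1 (fun l => (l - U_(i))%MM)).
  by rewrite !addmK => /val_inj.
apply: le_trans (aM d.+1).
apply: (@le_trans _ _ (\sum_(m in sh @: {: 'X_{1..n < d}}) weight r a (m : 'X_{1..n}))); last first.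
  rewrite big_mkcond /=; apply: ler_sum => m _; case: ifP => // _.
  exact: weight_ge0.
rewrite big_imset /=; last by move=> ? ? _ _; exact: sh_inj.
under [X in _ <= X]eq_bigl do rewrite inE.
apply: ler_sum => m _; rewrite /weight /= mulrCA mdegD mdeg1 addn1 -exprS.
case: ifP => // _; rewrite ComplexField.Normc.normc0 mul0r.
by rewrite mulr_ge0 ?normc_ge0 ?exprn_ge0// ltW.
Qed.

Lemma cps_mulX_coef (a : cps n R) i m :
  fps_coef (a * phi 'X_i : cps n R) m =
  if m i != 0%N then fps_coef a (m - U_(i))%MM else 0.
Proof.
rewrite (cps_mul_coef _ _ (ltnSn _)); case: eqP => [mi|/eqP mi] /=.
  rewrite mcoeffM big1// => -[k l] /= /eqP mE; rewrite mcoeffX.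
  case: eqP => [lE|]; last by rewrite mulr0.
  by move: mi; rewrite [in m i]mE mnmDE -lE mnm1E eqxx addn1.
have mE : (U_(i) + (m - U_(i)))%MM = m by rewrite addmC submK// lep1mP.
rewrite -[X in _@_X]mE mcoeffMX fps_truncE// ltnS -[X in (_ <= mdeg X)%N]mE mdegD.
exact: leq_addl.
Qed.

Lemma cps_residue (z : cps n R) : exists c : C, z - phi c%:MP \in ideal_ext phi O.
Proof.
exists (fps_coef z 0%MM).
have zP i : fps_quotX i z \in @convergent_pred n R.
  by apply/asboolP/convergent_quotX/asboolP; case: z.
suff -> : z - phi (fps_coef z 0%MM)%:MP = \sum_i (Cps (zP i) * phi 'X_i).
  apply: rpred_sum => i _; apply/idealM/ideal_ext_sub.
  by rewrite in_origin mcoeffX mnm1_eq0.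
apply/val_inj/fpsP => m.
have sumE (F : 'I_n -> cps n R) : fps_coef (\sum_i F i : cps n R) m = \sum_i fps_coef (F i) m.
  by elim/big_rec2: _ => [//|i y x _ <-].
rewrite [LHS]/= mcoeffC.
transitivity (\sum_i (if pick_var m == Some i then fps_coef z m else 0)).
  rewrite /pick_var; case: pickP => [i mi|m0].
    rewrite -big_mkcond /= (big_pred1 i); last by move=> j; rewrite eq_sym.
    case: eqP => [m0|_]; last by rewrite mulr0 subr0.
    by move: mi; rewrite m0 mnm0E.
  have -> : m = 0%MM by apply/mnmP => i; rewrite mnm0E; apply/eqP; have /negbFE := m0 i.
  by rewrite eqxx mulr1 subrr big1.
rewrite sumE; apply: eq_bigr => i _; rewrite cps_mulX_coef.
case: (eqVneq (m i) 0%N) => mi /=.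
  case: eqP => // /esym; rewrite /pick_var; case: pickP => // j mj [ij].
  by move: mj; rewrite -ij mi.
by rewrite submK// lep1mP.
Qed.

Lemma cps_local_like : local_like phi.
Proof.
split=> [s|z|N f]; [exact: cps_inverse|exact: cps_residue|].
by move=> /cps_order f0; apply/order_idealP => m /f0.
Qed.

End ConvergentLocalLike.

(** * The comparison theorem *)

Theorem theorem3p3 (R : realType) (t : nat) (g : 'I_t -> {mpoly R[i][2]}) :
  let b : ideal {mpoly R[i][2]} := ideal_gen (range g) in
  krull_dim_is (quot b) 0 ->
  zero_locus b (origin 2 R[i]) ->
  exists f : {rmorphism quot (ideal_ext (@to_loc_mpoly 2 R[i]) b) ->
                        quot (ideal_ext (@cps_of_mpoly 2 R) b)},
    scalable f /\ bijective f.
Proof.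
move=> b dim0 bO; have [s [N [Os sb]]] := krull_dim0_order_sub dim0 bO.
have locL := loc_local_like 2 R[i]; have cpsL := cps_local_like 2 R.
have locS := quot_ext_surj locL Os sb; have cpsS := quot_ext_surj cpsL Os sb.
have kerE f := iff_trans (quot_ext_ker locL Os sb f) (iff_sym (quot_ext_ker cpsL Os sb f)).
exact (quot_iso_of_surj (@to_loc_mpolyZ 2 R[i]) (@cps_of_mpolyZ 2 R) locS cpsS kerE).
Qed.
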